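(* Let $\mathcal Q$ be a family of feasible transition sets, and let $W_T=y$ and $$W_t(s)=\max_{a\in\mathcal A_t}\min_{q\in\mathcal Q_t(s,a)}\sum_{s'\in\mathcal S_{t+1}(s,a)}q(s')W_{t+1}(s')$$ be the maximin recursion. Suppose sequential exchangeability and positivity hold for every state–action cell evaluated by the maximisation: for every $t\in\{0,\dots,T-1\}$, every $s\in\mathcal S_t$ and every candidate action $a\in\mathcal A$, $P(S_t=s,A_t=a)>0$, so that $\mathcal Q_t(s,a)=\{P(S_{t+1}\in\cdot\mid S_t=s,A_t=a)\}$ at every such cell. Then the recursion reduces to $$Q_t(s,a)=\sum_{s'\in\mathcal S_{t+1}(s,a)}P(S_{t+1}=s'\mid S_t=s,A_t=a)\,W_{t+1}(s'),\qquad W_t(s)=\max_{a\in\mathcal A}Q_t(s,a),$$ for $t=0,\dots,T-1$, and the greedy policy $d_t^*(s)\in\operatorname*{arg\,max}_{a}Q_t(s,a)$ is the standard Q-learning optimal policy. In particular, with $S_t=\bar H_t=(L_0,A_0,\dots,L_t)$ (write $H_t=\bar H_t$), this $Q_t$ is exactly the history-based Q-learning action-value function, satisfying $$Q_t(h_t,a_t)=\mathbb E\Bigl[\max_{a_{t+1}}Q_{t+1}(H_{t+1},a_{t+1})\,\Big|\,H_t=h_t,\,A_t=a_t\Bigr]\qquad(0\le t\le T-2),$$ and $W_t(h_t)=\max_{a_t}Q_t(h_t,a_t)$ is the corresponding optimal value function.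
   Context: **Spaces.** $T\ge1$; state spaces $\mathcal S_0,\dots,\mathcal S_T$, treatment space $\mathcal A$ and outcome space $\mathcal Y\subseteq\mathbb R$ are finite; $Y=y(S_T)$ with $y:\mathcal S_T\to\mathcal Y$ known. $\Delta(X)$ denotes probability distributions on a finite set $X$. **Model.** A structural causal model (SCM) $M$ has mutually independent exogenous variables $\varepsilon_0^S$, $\varepsilon_t^U,\varepsilon_t^A,\varepsilon_{t+1}^S$ ($0\le t\le T-1$) and equations $S_0=f_0^S(\varepsilon_0^S)$, $U_t=f_t^U(\varepsilon_t^U)$, $A_t=f_t^A(S_t,U_t,\varepsilon_t^A)$, $S_{t+1}=f_{t+1}^S(S_t,A_t,U_t,\varepsilon_{t+1}^S)$, with $S_t\in\mathcal S_t$, $A_t\in\mathcal A$. Its kernel is $\kappa_{M,t}(\cdot\mid s,a)=$ law of $f_{t+1}^S(s,a,U_t,\varepsilon_{t+1}^S)$. Fixed nonempty sets $\mathcal S_{t+1}(s,a)\subseteq\mathcal S_{t+1}$ contain all values of $f_{t+1}^S(s,a,\cdot,\cdot)$. A graph $G$ specifies at which steps a bidirected edge $A_t\leftrightarrow S_{t+1}$ is present; where absent, $U_t$ may not enter both the $A_t$- and $S_{t+1}$-equations. The data come from a fixed true SCM $M^\star$ satisfying these requirements, with observational law $P$; $\kappa_t=\kappa_{M^\star,t}$. Expectations $\mathbb E$ in the recursion are under $P$. **Root convention.** $\mathcal S_{-1}=\{*\}$, $\mathcal A_{-1}=\{\star\}$, $\mathcal S_0( *,\star)=\mathcal S_0$,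 $\kappa_{-1}(\cdot\mid*,\star)=P(S_0\in\cdot)$; $\mathcal A_t=\mathcal A$ for $t\ge0$. The maximin recursion runs over $t=T-1,\dots,-1$ and $s\in\mathcal S_t$. **Feasible sets.** A family of feasible transition sets $\mathcal Q=\{\mathcal Q_t(s,a):t=-1,\dots,T-1,s\in\mathcal S_t,a\in\mathcal A_t\}$ consists of nonempty compact convex sets $\mathcal Q_t(s,a)\subseteq\Delta(\mathcal S_{t+1}(s,a))$ with $\kappa_t(\cdot\mid s,a)\in\mathcal Q_t(s,a)$. **Sequential exchangeability.** $A_t\perp\!\!\!\perp(S_{t+1}^{\bar a},\dots,S_T^{\bar a},Y^{\bar a})\mid S_t$ for every $t$ and every compatible treatment history $\bar a$ (with $S_t=\bar H_t$ in the history formulation), superscripts denoting counterfactuals obtained by setting the treatments to $\bar a$ in the structural equations. **Standard Q-learning.** The Q-learning action-value functions are defined by the finite-horizon backward recursion $Q^{\mathrm{QL}}_{T-1}(s,a)=\mathbb E[y(S_T)\mid S_{T-1}=s,A_{T-1}=a]$ and $Q^{\mathrm{QL}}_t(s,a)=\mathbb E[\max_{a'\in\mathcal A}Q^{\mathrm{QL}}_{t+1}(S_{t+1},a')\mid S_t=s,A_t=a]$ for $0\le t\le T-2$; a Q-learning optimal policy is any $d$ with $d_t(s)\in\operatorname*{arg\,max}_aQ^{\mathrm{QL}}_t(s,a)$ for all $t,s$. The history-based action-value function is $Q_t^{\mathrm{QL}}$ with $S_t=H_t$.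
   Formalization: That each feasible set Q_t(s,a) has at most one element is assumed: exchangeability and positivity do not imply it (Q_t(s,a) could be the whole simplex). That its single point is P(S_{t+1}∈·|S_t=s,A_t=a) is proved. *)

(* Defs.v *)
From HB Require Import structures.
From mathcomp Require Import all_boot all_order all_algebra.
From mathcomp Require Import all_classical all_reals all_analysis.

Set Implicit Arguments.
Unset Strict Implicit.
Unset Printing Implicit Defensive.
Import Order.TTheory GRing.Theory Num.Theory.
Import numFieldNormedType.Exports.

Local Open Scope classical_set_scope.
Local Open Scope ring_scope.

(* Time-indexed objects are indexed by all of [nat] to avoid casts between
   ordinals; every hypothesis of probabilistic content, every recursion and every
   conclusion is restricted to the stages 0, ..., T of the horizon, so whatever
   happens after T is irrelevant.  The exogenous variables live on an arbitrary
   probability space and take values in arbitrary measurable spaces.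
   [fS t] and [eS t] are the equation and the noise of S_{t+1}. *)
Record scm (R : realType) (T : nat) (S : nat -> finType) (A : finType) := Scm {
  dOmega : measure_display;  Omega : measurableType dOmega;
  prob : probability Omega R;
  dE0 : measure_display;  E0 : measurableType dE0;
  dEU : measure_display;  EU : nat -> measurableType dEU;
  dEA : measure_display;  EA : nat -> measurableType dEA;
  dES : measure_display;  ES : nat -> measurableType dES;
  dU  : measure_display;  U  : nat -> measurableType dU;
  e0 : Omega -> E0;
  eU : forall t, Omega -> EU t;
  eA : forall t, Omega -> EA t;
  eS : forall t, Omega -> ES t;
  f0 : E0 -> S 0%N;
  fU : forall t, EU t -> U t;
  fA : forall t, S t -> U t -> EA t -> A;
  fS : forall t, S t -> A -> U t -> ES t -> S t.+1;
  measurable_e0 : measurable_fun setT e0;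
  measurable_eU : forall t, measurable_fun setT (eU t);
  measurable_eA : forall t, measurable_fun setT (eA t);
  measurable_eS : forall t, measurable_fun setT (eS t);
  measurable_f0 : forall s, measurable [set e | f0 e = s];
  measurable_fU : forall t, measurable_fun setT (@fU t);
  measurable_fA : forall t s a,
    measurable [set ue : U t * EA t | @fA t s ue.1 ue.2 = a];
  measurable_fS : forall t s a s',
    measurable [set ue : U t * ES t | @fS t s a ue.1 ue.2 = s'];
  (* Taking some of the sets to be [setT] gives every subfamily. *)
  mutually_independent_exogenous :
    forall (B0 : set E0) (BU : forall t, set (EU t))
           (BA : forall t, set (EA t)) (BS : forall t, set (ES t)),
      measurable B0 -> (forall t, measurable (BU t)) ->
      (forall t, measurable (BA t)) -> (forall t, measurable (BS t)) ->
      fine (prob [set w | B0 (e0 w) /\ forall t, (t < T)%N ->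
                  [/\ BU t (eU t w), BA t (eA t w) & BS t (eS t w)]]) =
      fine (prob (e0 @^-1` B0)) *
      \prod_(0 <= t < T) (fine (prob (eU t @^-1` BU t)) *
                          fine (prob (eA t @^-1` BA t)) *
                          fine (prob (eS t @^-1` BS t))) }.

Section Processes.
Context {R : realType} {T : nat} {S : nat -> finType} {A : finType}.
Variable M : scm R T S A.

Definition latent t (w : Omega M) : U M t := fU (eU t w).

Fixpoint state t (w : Omega M) : S t :=
  match t with
  | 0 => f0 (e0 w)
  | t'.+1 => let s := state t' w in
             fS s (fA s (latent t' w) (eA t' w)) (latent t' w) (eS t' w)
  end.

Definition treatment t (w : Omega M) : A :=
  fA (state t w) (latent t w) (eA t w).

(* S_t^abar: every treatment equation is replaced by A_t := abar_t. *)
Fixpoint cf_state (abar : nat -> A) t (w : Omega M) : S t :=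
  match t with
  | 0 => f0 (e0 w)
  | t'.+1 => fS (cf_state abar t' w) (abar t') (latent t' w) (eS t' w)
  end.

Definition Pr (E : set (Omega M)) : R := fine (prob M E).

Definition condPr (E F : set (Omega M)) : R := Pr (E `&` F) / Pr F.

Definition condE (X : Omega M -> R) (F : set (Omega M)) : R :=
  fine (expectation (prob M) (fun w => X w * \1_F w)) / Pr F.

Definition cell t (s : S t) (a : A) : set (Omega M) :=
  [set w | state t w = s /\ treatment t w = a].

(* P(S_{t+1} = . | S_t = s, A_t = a) *)
Definition obs_law t (s : S t) (a : A) : S t.+1 -> R :=
  fun s' => condPr [set w | state t.+1 w = s'] (cell s a).

Definition kernel t (s : S t) (a : A) : S t.+1 -> R :=
  fun s' => Pr [set w | fS s a (latent t w) (eS t w) = s'].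

Definition root_kernel : S 0%N -> R := fun s => Pr [set w | state 0 w = s].

(* [G t] says that the bidirected edge A_t <-> S_{t+1} is present. *)
Definition respects_graph (G : pred nat) := forall t, (t < T)%N -> ~~ G t ->
  (forall s u u' (e : EA M t), fA s u e = fA s u' e) \/
  (forall s a u u' (e : ES M t), fS s a u e = fS s a u' e).

Definition respects_support (supp : forall t, S t -> A -> {set S t.+1}) :=
  forall t (s : S t) a, (t < T)%N ->
    supp t s a != finset.set0 /\
    forall (u : U M t) (e : ES M t), fS s a u e \in supp t s a.

Definition positivity := forall t (s : S t) (a : A), (t < T)%N ->
  0 < Pr (cell s a).

(* A treatment history abar is compatible with the data before t when
   A_k = abar_k for k < t; this is part of the conditioning event.  If S_t is the
   whole history, that event is {S_t = s} when abar agrees with the treatments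
   recorded in s, and is empty otherwise.  Independence of A_t and of the vector
   (S_{t+1}^abar, ..., S_T^abar, Y^abar) is tested on measurable rectangles, in
   product form so that null conditioning events impose nothing. *)
Definition compatible_event (abar : nat -> A) t (s : S t) : set (Omega M) :=
  [set w | state t w = s /\ forall k, (k < t)%N -> treatment k w = abar k].

Definition cf_event (y : S T -> R) (abar : nat -> A) t
    (B : forall k, {set S k}) (C : set R) : set (Omega M) :=
  [set w | (forall k, (t < k <= T)%N -> cf_state abar k w \in B k) /\
           C (y (cf_state abar T w))].

Definition sequential_exchangeability (y : S T -> R) :=
  forall t (s : S t) (abar : nat -> A) (a : A) (B : forall k, {set S k})
         (C : set R), (t < T)%N ->
    let F := compatible_event abar s in
    let At := [set w | treatment t w = a] in
    let St := cf_event y abar t B C in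
    Pr (At `&` St `&` F) * Pr F = Pr (At `&` F) * Pr (St `&` F).

End Processes.

Arguments latent {R T S A} M t w.
Arguments state {R T S A} M t w.
Arguments treatment {R T S A} M t w.
Arguments cell {R T S A} M {t} s a.
Arguments obs_law {R T S A} M {t} s a _.
Arguments kernel {R T S A} M {t} s a _.
Arguments root_kernel {R T S A} M _.

(* Delta(D), for D a subset of X, as functions on X vanishing outside of D. *)
Definition simplex_on {R : realType} {X : finType} (D : {set X}) : set (X -> R) :=
  [set q | [/\ forall x, 0 <= q x, \sum_x q x = 1 &
               forall x, x \notin D -> q x = 0]].

(* On R^X with X finite the pointwise topology is the Euclidean one. *)
Definition feasible_set {R : realType} {X : finType} (D : {set X})
    (k : X -> R) (C : set (X -> R)) :=
  [/\ C `<=` simplex_on D, compact (C : set {ptws X -> R}),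
      convex_set (C : set (convex_lmodType (X -> R^o))) & C k].

(* [root_set] is Q_{-1}, indexed by the one-point S_{-1} and A_{-1}. *)
Record feasible_family {R : realType} {T : nat} {S : nat -> finType}
    {A : finType} (M : scm R T S A) (supp : forall t, S t -> A -> {set S t.+1})
  := FeasibleFamily {
  root_set : set (S 0%N -> R);
  step_set : forall t, S t -> A -> set (S t.+1 -> R);
  root_feasible : feasible_set finset.setT (root_kernel M) root_set;
  step_feasible : forall t (s : S t) a, (t < T)%N ->
    feasible_set (supp t s a) (kernel M s a) (step_set s a) }.

(* Applied below only to a nonempty finite set and to a nonempty compact set of
   reals respectively, where the supremum and the infimum are attained. *)
Definition max_over {R : realType} {A : finType} (f : A -> R) : R := sup (range f).
Definition min_over {R : realType} {X : Type} (C : set X) (f : X -> R) : R :=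
  inf (f @` C).

Definition argmax {R : realType} {A : finType} (f : A -> R) : set A :=
  [set a | forall a', f a' <= f a].

Section Recursions.
Context {R : realType} {T : nat} {S : nat -> finType} {A : finType}.
Variable M : scm R T S A.
Variable supp : forall t, S t -> A -> {set S t.+1}.

Definition maximin_Q (Q : feasible_family M supp) (W : forall t, S t -> R)
    t (s : S t) (a : A) : R :=
  min_over (step_set Q s a) (fun q => \sum_(s' in supp s a) q s' * W t.+1 s').

(* Q_t(s, a) in the reduced recursion. *)
Definition reduced_Q (W : forall t, S t -> R) t (s : S t) (a : A) : R :=
  \sum_(s' in supp s a) obs_law M s a s' * W t.+1 s'.

(* [Wroot] is W_{-1}; the maximum over A_{-1} is over a single element. *)
Definition maximin_recursion (Q : feasible_family M supp) (y : S T -> R)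
    (W : forall t, S t -> R) (Wroot : R) :=
  [/\ W T = y,
      forall t (s : S t), (t < T)%N -> W t s = max_over (maximin_Q Q W s)
    & Wroot = min_over (root_set Q) (fun q => \sum_s q s * W 0%N s)].

Definition q_learning (y : S T -> R) (QL : forall t, S t -> A -> R) :=
  (forall t (s : S t) a, t.+1 = T ->
     QL t s a = condE (fun w => y (state M T w)) (cell M s a)) /\
  (forall t (s : S t) a, (t.+1 < T)%N ->
     QL t s a = condE (fun w => max_over (QL t.+1 (state M t.+1 w))) (cell M s a)).

(* For [Qf := QL] these are the Q-learning optimal policies. *)
Definition greedy (Qf : forall t, S t -> A -> R) (d : forall t, S t -> A) :=
  forall t (s : S t), (t < T)%N -> argmax (Qf t s) (d t s).

End Recursions.

Arguments reduced_Q {R T S A} M supp W t s a.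
Arguments greedy {R} T {S A} Qf d.

(* Histories (L_0, A_0, ..., A_{t-1}, L_t). *)
Fixpoint hist (L : nat -> finType) (A : finType) (t : nat) : finType :=
  match t with
  | 0 => L 0%N
  | t'.+1 => (hist L A t' * A * L t'.+1)%type
  end.

Definition hist_past (L : nat -> finType) (A : finType) t
  (h : hist L A t.+1) : hist L A t * A := h.1.

(* S_{t+1} = (S_t, A_t, L_{t+1}) structurally, hence S_t = H_t. *)
Definition history_scm {R : realType} {T : nat} {L : nat -> finType}
    {A : finType} (M : scm R T (hist L A) A) :=
  forall t (h : hist L A t) a (u : U M t) (e : ES M t), (t < T)%N ->
    hist_past (fS h a u e) = (h, a).

(* Main.v *)
Require Import Defs.
From HB Require Import structures.
From mathcomp Require Import all_boot all_order all_algebra.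
From mathcomp Require Import all_classical all_reals all_analysis.

Set Implicit Arguments.
Unset Strict Implicit.
Unset Printing Implicit Defensive.
Import Order.TTheory GRing.Theory Num.Theory.
Import numFieldNormedType.Exports.

Local Open Scope classical_set_scope.
Local Open Scope ring_scope.

(* Among the units with S_t = s whose past treatments agree with abar, S_{t+1}^abar
   is the structural equation of S_{t+1} applied to (s, abar_t) and to the noises
   of stage t, which are independent of everything that happened before t; so its
   law is the kernel at (s, abar_t).  By sequential exchangeability this remains
   true after conditioning on A_t = abar_t, when S_{t+1}^abar is the observed
   S_{t+1}.  Summing over the possible past treatments gives
   P(S_{t+1} = . | S_t = s, A_t = a) = kappa_t(. | s, a), which belongs to
   Q_t(s, a) and is therefore its only point.  The minima thus disappear from the
   maximin recursion, and what remains is the Q-learning recursion. *)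

(** * From independence on pi-systems to independence of the generated sigma-algebras *)

Section SigmaAlgebraIndependence.
Context {d : measure_display} {R : realType} {Omega : measurableType d}.
Variable P : probability Omega R.
Local Open Scope ereal_scope.

(** As functions of [E], both sides are finite measures, namely [P] restricted to [F] and [P] scaled
    by the number [P F]. They agree on the pi-system [G], hence on what it generates. *)
Let independent_g_sigmal (G : set (set Omega)) (F : set Omega) :
  setI_closed G -> G setT -> G `<=` measurable -> measurable F ->
  (forall E, G E -> P (E `&` F) = P E * P F) ->
  forall E, <<s G >> E -> P (E `&` F) = P E * P F.
Proof.
move=> GI GT Gm mF GF E GE.
have PF0 : (0 <= fine (P F))%R by exact: fine_ge0.
pose m1 : measure Omega R := mrestr P mF.
pose m2 : measure Omega R := mscale (NngNum PF0) P.
have m2E X : m2 X = P X * P F.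
  by rewrite /m2/= /mscale/= fineK ?fin_num_measure// muleC.
(* The uniqueness theorem asks for a covering sequence in [G] of finite mass; the constant sequence
   [setT] serves. *)
rewrite -m2E; apply: (@g_sigma_algebra_measure_unique _ _ _ G Gm
  (fun=> setT) _ _ m1 m2) => //.
- by rewrite bigcup_const//; exists 0%N.
- by move=> X GX; rewrite m2E; exact: GF.
- move=> _; rewrite /m1/= /mrestr setTI (le_lt_trans (probability_le1 _ _))//.
  exact: ltry.
Qed.

(** The one-sided extension is used twice: over [H] with [E] fixed in the sigma-algebra of [G], then
    over [G] with a fixed generator of [H]. *)
Lemma independent_g_sigma (G H : set (set Omega)) :
  setI_closed G -> G setT -> G `<=` measurable ->
  setI_closed H -> H setT -> H `<=` measurable ->
  (forall E F, G E -> H F -> P (E `&` F) = P E * P F) ->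
  forall E F, <<s G >> E -> <<s H >> F -> P (E `&` F) = P E * P F.
Proof.
move=> GI GT Gm HI HT Hm GH E F GE HF.
have mE : measurable E by exact: (smallest_sub (@sigma_algebra_measurable _ _) Gm).
rewrite setIC muleC; apply: (independent_g_sigmal HI HT Hm mE) HF => F' HF'.
rewrite setIC muleC; apply: (independent_g_sigmal GI GT Gm (Hm _ HF')) GE.
by move=> E' GE'; exact: GH.
Qed.

End SigmaAlgebraIndependence.

(** * Expectations and total probability for finite-valued variables *)

Section FiniteValued.
Context {d : measure_display} {R : realType} {Omega : measurableType d}.
Variables (P : probability Omega R) (I : finType) (X : Omega -> I).
Hypothesis mX : forall i, measurable [set w | X w = i].

(** The integrand is a finite combination of the indicators of [[set w | X w = i]] intersected with
    [F], so the integral is a finite sum. *)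
Lemma expectation_finite_valued (g : I -> R) (F : set Omega) :
  measurable F ->
  expectation P (fun w => g (X w) * \1_F w) =
  (\sum_i g i * fine (P ([set w | X w = i] `&` F)))%:E.
Proof.
move=> mF.
have mXF i : measurable ([set w | X w = i] `&` F) by exact: measurableI.
rewrite unlock.
rewrite (_ : (fun w => _) = fun w =>
    (\sum_i (g i)%:E * (\1_([set w | X w = i] `&` F) w)%:E)%E); last first.
  apply/funext => w; rewrite sumEFin; congr (_%:E).
  rewrite (bigD1 (X w))//= big1 ?addr0 => [|i /eqP iX].
    by rewrite indicI /= [in RHS]indicE mem_set// mul1r.
  by rewrite indicI /= [X in _ * (X * _)]indicE memNset ?mul0r ?mulr0// => /esym.
rewrite integral_sum//; last first.
  by move=> i; apply: integrableZl => //; exact: integrable_indic.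
rewrite -sumEFin; apply: eq_bigr => i _.
rewrite integralZl//; last exact: integrable_indic.
by rewrite integral_indic// setIT EFinM fineK// fin_num_measure.
Qed.

Lemma fine_probability_sum (F : set Omega) : measurable F ->
  fine (P F) = \sum_i fine (P ([set w | X w = i] `&` F)).
Proof.
move=> mF; have := expectation_finite_valued (fun=> 1) mF.
under eq_fun do rewrite mul1r.
rewrite expectation_indic// => ->/=.
by apply: eq_bigr => i _; rewrite mul1r.
Qed.

End FiniteValued.

(** * Events determined by the exogenous noises of selected stages, and their independence *)

Section ExogenousCylinders.
Context {R : realType} {T : nat} {S : nat -> finType} {A : finType}.
Variable M : scm R T S A.

(** One side of a rectangle for each exogenous variable; [cylinder] ignores the sides at stages from
    [T] on. *)
Record box := Box {
  box0 : set (E0 M);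
  boxU : forall t, set (EU M t);
  boxA : forall t, set (EA M t);
  boxS : forall t, set (ES M t) }.
Arguments boxU : clear implicits.
Arguments boxA : clear implicits.
Arguments boxS : clear implicits.

Definition cylinder (B : box) : set (Omega M) :=
  [set w | box0 B (e0 w) /\ forall t, (t < T)%N ->
    [/\ boxU B t (eU t w), boxA B t (eA t w) & boxS B t (eS t w)]].

Definition boxT := Box setT (fun=> setT) (fun=> setT) (fun=> setT).

Definition boxI (B C : box) :=
  Box (box0 B `&` box0 C) (fun t => boxU B t `&` boxU C t)
      (fun t => boxA B t `&` boxA C t) (fun t => boxS B t `&` boxS C t).

Definition measurable_box (B : box) :=
  [/\ measurable (box0 B), forall t, measurable (boxU B t),
      forall t, measurable (boxA B t) & forall t, measurable (boxS B t)].

Definition constrains (b : bool) (I : pred nat) (B : box) :=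
  (~~ b -> box0 B = setT) /\
  forall t, ~~ I t -> [/\ boxU B t = setT, boxA B t = setT & boxS B t = setT].

(* [I] selects stages; [b] tells whether the noise of S_0 may be constrained too. *)
Definition cylinders (b : bool) (I : pred nat) : set (set (Omega M)) :=
  [set E | exists B, [/\ measurable_box B, constrains b I B & E = cylinder B]].

Lemma cylinder_boxI (B C : box) :
  cylinder (boxI B C) = cylinder B `&` cylinder C.
Proof.
apply/seteqP; split=> w; rewrite /cylinder /=.
  by move=> [[? ?] H]; split; split=> // t /H [[? ?] [? ?] [? ?]]; split.
by move=> [[? HB] [? HC]]; split=> // t tT; have [? ? ?] := HB t tT;
  have [? ? ?] := HC t tT; split.
Qed.

Lemma cylinder_boxT : cylinder boxT = setT.
Proof. by apply/seteqP; split=> // w _; split=> // t _; split. Qed.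

Lemma cylindersT b I : cylinders b I setT.
Proof. by exists boxT; split; [split=> /=|split|rewrite cylinder_boxT]. Qed.

Lemma measurable_boxI (B C : box) :
  measurable_box B -> measurable_box C -> measurable_box (boxI B C).
Proof.
by move=> [? ? ? ?] [? ? ? ?]; split => [|t|t|t]; exact: measurableI.
Qed.

Lemma cylinders_setI b I : setI_closed (cylinders b I).
Proof.
move=> _ _ [B [mB [B0 BI] ->]] [C [mC [C0 CI] ->]]; exists (boxI B C).
rewrite cylinder_boxI; split=> //; first exact: measurable_boxI.
split=> [nb|t nIt] /=; first by rewrite B0// C0// setIT.
by have [-> -> ->] := BI t nIt; have [-> -> ->] := CI t nIt; rewrite !setIT.
Qed.

Lemma measurable_cylinder (B : box) : measurable_box B -> measurable (cylinder B).
Proof.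
move=> [m0 mU mA mS].
rewrite (_ : cylinder B = (@e0 _ _ _ _ M) @^-1` box0 B `&` \bigcap_(t in `I_T)
  ((@eU _ _ _ _ M t) @^-1` boxU B t `&` ((@eA _ _ _ _ M t) @^-1` boxA B t `&`
   (@eS _ _ _ _ M t) @^-1` boxS B t))); last first.
  apply/seteqP; split=> w [B0 H]; split=> // t tT; first by have [] := H t tT.
  by have [? []] := H t tT.
apply: measurableI; first by rewrite -[X in measurable X]setTI; exact: measurable_e0.
apply: fin_bigcap_measurable => [|t _]; first exact: finite_II.
apply: measurableI; [|apply: measurableI]; rewrite -[X in measurable X]setTI.
- exact: (measurable_eU measurableT (mU t)).
- exact: (measurable_eA measurableT (mA t)).
- exact: (measurable_eS measurableT (mS t)).
Qed.

Lemma cylinders_measurable b I : cylinders b I `<=` measurable.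
Proof. by move=> _ [B [mB _ ->]]; exact: measurable_cylinder. Qed.

Lemma g_cylinders_measurable b I E : <<s cylinders b I >> E -> measurable E.
Proof.
exact: (smallest_sub (@sigma_algebra_measurable _ _) (@cylinders_measurable b I)).
Qed.

Let box_prob (B : box) t :=
  Pr (@eU _ _ _ _ M t @^-1` boxU B t) * Pr (@eA _ _ _ _ M t @^-1` boxA B t) *
  Pr (@eS _ _ _ _ M t @^-1` boxS B t).

Let Pr_cylinder (B : box) : measurable_box B ->
  Pr (cylinder B) =
  Pr (@e0 _ _ _ _ M @^-1` box0 B) * \prod_(0 <= t < T) box_prob B t.
Proof. by move=> [? ? ? ?]; exact: mutually_independent_exogenous. Qed.

Lemma PrT : Pr [set: Omega M] = 1.
Proof. by rewrite /Pr probability_setT. Qed.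

(** The probability of a box is the product of the probabilities of its sides. For each noise at
    least one of the two boxes has the side [setT], which contributes a factor 1, so the product for
    the intersection splits. *)
Lemma cylinders_independent b I b' J E F :
  ~~ (b && b') -> (forall t, ~~ (I t && J t)) ->
  cylinders b I E -> cylinders b' J F -> Pr (E `&` F) = Pr E * Pr F.
Proof.
move=> bb' IJ [B [mB [B0 BI] ->]] [C [mC [C0 CJ] ->]].
rewrite -cylinder_boxI !Pr_cylinder//; last exact: measurable_boxI.
rewrite mulrACA -big_split/=; congr (_ * _).
  have [/B0 -> /=|/negPn b1] := boolP (~~ b).
    by rewrite setTI preimage_setT PrT mul1r.
  by rewrite C0 ?setIT ?preimage_setT ?PrT ?mulr1//; move: bb'; rewrite b1.
apply: eq_bigr => t _; rewrite /box_prob /=.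
have [/BI [-> -> ->] /=|/negPn It] := boolP (~~ I t).
  by rewrite !setTI !preimage_setT PrT !mul1r.
have [|-> -> ->] := CJ t; first by have := IJ t; rewrite It.
by rewrite !setIT !preimage_setT PrT !mulr1.
Qed.

(** Cylinders are a pi-system containing [setT], so their independence carries over to all events
    determined by disjoint groups of noises. *)
Lemma g_cylinders_independent b I b' J E F :
  ~~ (b && b') -> (forall t, ~~ (I t && J t)) ->
  <<s cylinders b I >> E -> <<s cylinders b' J >> F -> Pr (E `&` F) = Pr E * Pr F.
Proof.
move=> bb' IJ sE sF; rewrite /Pr.
have [mE mF] := (g_cylinders_measurable sE, g_cylinders_measurable sF).
rewrite (@independent_g_sigma _ _ _ (prob M) (cylinders b I) (cylinders b' J)) ?fineM ?fin_num_measure//.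
- exact: cylinders_setI.
- exact: cylindersT.
- exact: cylinders_measurable.
- exact: cylinders_setI.
- exact: cylindersT.
- exact: cylinders_measurable.
- move=> {sE mE sF mF}E {}F cE cF.
  have [mE mF] := (cylinders_measurable cE, cylinders_measurable cF).
  rewrite -(fineK (fin_num_measure _ _ (measurableI _ _ mE mF))).
  rewrite -(fineK (fin_num_measure _ _ mE)) -(fineK (fin_num_measure _ _ mF)).
  by rewrite -EFinM; congr EFin; exact: cylinders_independent cE cF.
Qed.

(** The sample space with a smaller sigma-algebra: being measurable here means being determined by
    the selected noises, and the general lemmas on measurable functions apply. *)
Local Notation cyl_sigma b I := (g_sigma_algebraType (cylinders b I)).

Let preimage_cylinder b I (B : box) (E : set (Omega M)) :
  measurable_box B -> constrains b I B -> E = cylinder B ->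
  measurable (E : set (cyl_sigma b I)).
Proof. by move=> mB cB ->; apply: sub_sigma_algebra; exists B. Qed.

Lemma cylinders_measurable_e0 I :
  measurable_fun setT (@e0 _ _ _ _ M : cyl_sigma true I -> E0 M).
Proof.
move=> _ B mB; rewrite setTI.
apply: (@preimage_cylinder _ _ (Box B (fun=> setT) (fun=> setT) (fun=> setT))) => //.
  by split=> /=.
by apply/seteqP; split=> [w Bw|w []//]; split=> // t _; split.
Qed.

(** Such a family, [B] at [t] and [setT] elsewhere, is the side of a box that restricts a single
    noise. It shows below that each noise of a selected stage is measurable for [cyl_sigma]. *)
Lemma measurable_dfwith (dE : measure_display) (E : nat -> measurableType dE)
    t (B : set (E t)) : measurable B ->
  forall k, measurable (dfwith (fun k : nat => [set: E k]) t B k).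
Proof. by move=> mB k; case: dfwithP => // j; rewrite measurableT. Qed.

Lemma cylinders_measurable_eU b (I : pred nat) t : I t -> (t < T)%N ->
  measurable_fun setT (@eU _ _ _ _ M t : cyl_sigma b I -> EU M t).
Proof.
move=> It tT _ B mB; rewrite setTI; apply: (@preimage_cylinder _ _
  (Box setT (dfwith (fun=> setT) t B) (fun=> setT) (fun=> setT))) => //.
- by split=> /= *; rewrite ?measurableT//; exact: measurable_dfwith.
- split=> // k nIk; split=> //=; rewrite dfwithout//.
  by apply: contraNneq nIk => <-.
- apply/seteqP; split=> [w Bw|w [_ /(_ t tT)[/=]]]; last by rewrite dfwithin.
  by split=> // k _; split=> //=; case: dfwithP.
Qed.

Lemma cylinders_measurable_eA b (I : pred nat) t : I t -> (t < T)%N ->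
  measurable_fun setT (@eA _ _ _ _ M t : cyl_sigma b I -> EA M t).
Proof.
move=> It tT _ B mB; rewrite setTI; apply: (@preimage_cylinder _ _
  (Box setT (fun=> setT) (dfwith (fun=> setT) t B) (fun=> setT))) => //.
- by split=> /= *; rewrite ?measurableT//; exact: measurable_dfwith.
- split=> // k nIk; split=> //=; rewrite dfwithout//.
  by apply: contraNneq nIk => <-.
- apply/seteqP; split=> [w Bw|w [_ /(_ t tT)[/= _]]]; last by rewrite dfwithin.
  by split=> // k _; split=> //=; case: dfwithP.
Qed.

Lemma cylinders_measurable_eS b (I : pred nat) t : I t -> (t < T)%N ->
  measurable_fun setT (@eS _ _ _ _ M t : cyl_sigma b I -> ES M t).
Proof.
move=> It tT _ B mB; rewrite setTI; apply: (@preimage_cylinder _ _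
  (Box setT (fun=> setT) (fun=> setT) (dfwith (fun=> setT) t B))) => //.
- by split=> /= *; rewrite ?measurableT//; exact: measurable_dfwith.
- split=> // k nIk; split=> //=; rewrite dfwithout//.
  by apply: contraNneq nIk => <-.
- apply/seteqP; split=> [w Bw|w [_ /(_ t tT)[/= _ _]]]; last by rewrite dfwithin.
  by split=> // k _; split=> //=; case: dfwithP.
Qed.

Lemma cylinders_measurable_fA b (I : pred nat) t s a : I t -> (t < T)%N ->
  measurable ([set w | fA s (latent M t w) (eA t w) = a] : set (cyl_sigma b I)).
Proof.
move=> It tT; have := measurable_fA (s0 := M) s a.
have : measurable_fun setT
    (fun w : cyl_sigma b I => (latent M t w, @eA _ _ _ _ M t w)).
  apply: measurable_fun_pair; last exact: cylinders_measurable_eA.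
  by apply: measurableT_comp; [exact: measurable_fU|exact: cylinders_measurable_eU].
by move=> /(_ measurableT) H /H; rewrite setTI.
Qed.

Lemma cylinders_measurable_fS b (I : pred nat) t s a s' : I t -> (t < T)%N ->
  measurable ([set w | fS s a (latent M t w) (eS t w) = s'] : set (cyl_sigma b I)).
Proof.
move=> It tT; have := measurable_fS (s0 := M) s a s'.
have : measurable_fun setT
    (fun w : cyl_sigma b I => (latent M t w, @eS _ _ _ _ M t w)).
  apply: measurable_fun_pair; last exact: cylinders_measurable_eS.
  by apply: measurableT_comp; [exact: measurable_fU|exact: cylinders_measurable_eU].
by move=> /(_ measurableT) H /H; rewrite setTI.
Qed.

(** The treatment equation is measurable in the noises only for a fixed state, so the event is split
    over the finitely many values of the state. *)
Lemma cylinders_measurable_treatment (I : pred nat) t a : I t -> (t < T)%N ->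
  (forall s, measurable ([set w | state M t w = s] : set (cyl_sigma true I))) ->
  measurable ([set w | treatment M t w = a] : set (cyl_sigma true I)).
Proof.
move=> It tT mS; rewrite (_ : [set _ | _] = \bigcup_(s in [set: S t])
  ([set w | state M t w = s] `&` [set w | fA s (latent M t w) (eA t w) = a])).
  apply: fin_bigcup_measurable => [|s _]; first exact: finite_finset.
  by apply: measurableI => //; exact: cylinders_measurable_fA.
by apply/seteqP; split=> w => [wa|[s _ [<-]]//]; exists (state M t w).
Qed.

(** Unfolding the equations, S_t reads the noise of S_0 and the noises of the stages before [t]
    only. The induction splits over the previous state and treatment. *)
Lemma cylinders_measurable_state (I : pred nat) t s :
  (forall k, (k < t)%N -> I k) -> (t <= T)%N ->
  measurable ([set w | state M t w = s] : set (cyl_sigma true I)).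
Proof.
elim: t s => [|t IHt] s It tT.
  have := @cylinders_measurable_e0 I measurableT _ (@measurable_f0 _ _ _ _ M s).
  by rewrite setTI.
have {}IHt s' : measurable ([set w | state M t w = s'] : set (cyl_sigma true I)).
  by apply: IHt; [move=> k kt; exact/It/ltnW|exact: ltnW].
rewrite (_ : [set _ | _] = \bigcup_(sa in [set: S t * A])
  (([set w | state M t w = sa.1] `&` [set w | treatment M t w = sa.2]) `&`
   [set w | fS sa.1 sa.2 (latent M t w) (eS t w) = s])).
  apply: fin_bigcup_measurable => [|[s' a] _ /=]; first exact: finite_finset.
  apply: measurableI; last by apply: cylinders_measurable_fS => //; exact: It.
  by apply: measurableI => //; apply: cylinders_measurable_treatment => //; exact: It.
apply/seteqP; split=> w => [ws|[[s' a] _ /= [[<- <-]]//]].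
by exists (state M t w, treatment M t w).
Qed.

End ExogenousCylinders.

Arguments cylinders {R T S A} M b I _.

(** * Observed transitions and structural kernels under sequential exchangeability *)

Section Transitions.
Context {R : realType} {T : nat} {S : nat -> finType} {A : finType}.
Variable M : scm R T S A.

Lemma state_measurable t s : (t <= T)%N -> measurable [set w | state M t w = s].
Proof.
move=> tT; apply: (@g_cylinders_measurable _ _ _ _ M true predT).
exact: cylinders_measurable_state.
Qed.

Lemma treatment_measurable t a :
  (t < T)%N -> measurable [set w | treatment M t w = a].
Proof.
move=> tT; apply: (@g_cylinders_measurable _ _ _ _ M true predT).
apply: cylinders_measurable_treatment => // s.
by apply: cylinders_measurable_state => //; exact: ltnW.
Qed.

Lemma cell_measurable t (s : S t) a : (t < T)%N -> measurable (cell M s a).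
Proof.
move=> tT; apply: measurableI; last exact: treatment_measurable.
exact/state_measurable/ltnW.
Qed.

(** The conditioning event of exchangeability belongs to the past: this makes it independent of the
    noises of stage [t]. *)
Lemma compatible_event_cylinders (abar : nat -> A) t (s : S t) : (t <= T)%N ->
  <<s cylinders M true [pred k | k < t]%N >> (compatible_event (M := M) abar s).
Proof.
move=> tT; rewrite (_ : compatible_event _ _ = [set w | state M t w = s] `&`
    \bigcap_(k in `I_t) [set w | treatment M k w = abar k])//.
pose past := g_sigma_algebraType (cylinders M true [pred k | k < t]%N).
apply: (@measurableI _ past); first exact: cylinders_measurable_state.
apply: (@fin_bigcap_measurable _ past) => [|k kt]; first exact: finite_II.
apply: cylinders_measurable_treatment => [//||s'].
  exact: leq_trans kt tT.
apply: cylinders_measurable_state => [j jk|]; first exact: ltn_trans jk kt.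
exact: ltnW (leq_trans kt tT).
Qed.

(** Consistency: an intervention that imposes the treatments already taken changes no state up to
    [t]. *)
Lemma cf_state_consistent (abar : nat -> A) t w :
  (forall k, (k < t)%N -> treatment M k w = abar k) ->
  cf_state abar t w = state M t w.
Proof.
elim: t => // t IHt H /=.
rewrite IHt => [|k kt]; last exact/H/ltnW.
by rewrite -(H t (ltnSn t)).
Qed.

(** With [s] and [a] fixed, the equation of S_{t+1} reads only noises of stage [t], whereas [F] is
    determined by the noise of S_0 and those of earlier stages. *)
Lemma kernel_independent_past t (s : S t) a s' F : (t < T)%N ->
  <<s cylinders M true [pred k | k < t]%N >> F ->
  Pr ([set w | fS s a (latent M t w) (eS t w) = s'] `&` F) =
  Pr F * Defs.kernel M s a s'.
Proof.
move=> tT sF; rewrite setIC.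
apply: (@g_cylinders_independent _ _ _ _ M true [pred k | k < t]%N false (pred1 t)) => //.
  by move=> k /=; case: ltngtP.
by apply: cylinders_measurable_fS => //=.
Qed.

Lemma Pr_le (E F : set (Omega M)) :
  measurable E -> measurable F -> E `<=` F -> Pr E <= Pr F.
Proof.
move=> mE mF EF; rewrite fine_le ?fin_num_measure//.
by rewrite le_measure ?inE.
Qed.

(** The past treatments are fixed by [H] because exchangeability conditions on them, and because the
    counterfactual state is known to be the factual one only there. The product form allows [H] to
    have probability zero. *)
Lemma exchangeable_transition (y : S T -> R) (abar : nat -> A) t (s : S t)
    (s' : S t.+1) :
  sequential_exchangeability M y -> (t < T)%N ->
  let H := [set w | forall k, (k < t)%N -> treatment M k w = abar k] in
  Pr (H `&` ([set w | state M t.+1 w = s'] `&` cell M s (abar t))) =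
  Defs.kernel M s (abar t) s' * Pr (H `&` cell M s (abar t)).
Proof.
move=> exch tT H; set F := compatible_event (M := M) abar s.
have sF : <<s cylinders M true [pred k | k < t]%N >> F.
  by apply: compatible_event_cylinders; exact: ltnW.
have mF := g_cylinders_measurable sF.
pose At := [set w | treatment M t w = abar t].
pose St' := [set w | state M t.+1 w = s'].
have mAt : measurable At by exact: treatment_measurable.
have mSt' : measurable St' by exact: state_measurable.
have HF : H `&` cell M s (abar t) = At `&` F.
  by apply/seteqP; split=> w; [move=> [? [? ?]]|move=> [? [? ?]]].
have HSF : H `&` (St' `&` cell M s (abar t)) = St' `&` (At `&` F).
  by rewrite -HF setICA.
(* The chosen rectangle restricts S_{t+1}^abar to [s'] and leaves later states and the outcome
   free. *)
have := exch t s abar (abar t)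
  (dfwith (fun k => finset.setTfor (S k)) t.+1 (finset.set1 s')) setT tT.
have FS w : F w -> fS s (abar t) (latent M t w) (eS t w) = cf_state abar t.+1 w.
  by move=> [ws wA] /=; rewrite (cf_state_consistent wA) ws.
rewrite /= -/F -/At; set St := cf_event _ _ _ _ _.
have StF : St `&` F = [set w | fS s (abar t) (latent M t w) (eS t w) = s'] `&` F.
  apply/seteqP; split=> w [wS Fw]; split=> //=.
    have [+ _] := wS; move=> /(_ t.+1); rewrite ltnSn tT => /(_ isT).
    by rewrite dfwithin inE FS// => /eqP.
  split=> // k; case: dfwithP => [_|j _ _]; last by rewrite inE.
  by rewrite -FS// inE; apply/eqP.
(* Once A_t = abar_t holds as well, the counterfactual next state is the observed one. *)
have AStF : At `&` St `&` F = St' `&` (At `&` F).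
  rewrite -setIA StF setICA; apply/seteqP.
  split=> w [ws' [wA Fw]]; split=> //; have [ws _] := Fw.
    by rewrite /St'/= ws -/(treatment M t w); move: ws' wA; rewrite /At/=/treatment ws => <- ->.
  by move: ws' wA; rewrite /St' /At/= /treatment ws => <- ->.
rewrite StF AStF kernel_independent_past// HSF HF.
(* Exchangeability now gives the claim multiplied by [Pr F]. This factor cancels if nonzero;
   otherwise both sides of the claim concern subsets of a null event. *)
have [F0|F0] := eqVneq (Pr F) 0; last first.
  move=> E; apply: (mulIf F0).
  by rewrite E (mulrC (Pr F)) mulrA (mulrC (Pr (At `&` F))).
have null E : measurable E -> E `<=` F -> Pr E = 0.
  move=> mE EF; apply/eqP; rewrite eq_le fine_ge0// andbT -[leRHS]F0.
  exact: Pr_le.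
by move=> _; rewrite !null ?mulr0//; do ?apply: measurableI => //; move=> w [_ []].
Qed.

(** Given the cell, the kernel is the same factor for every past treatment sequence, so total
    probability over these sequences removes the conditioning on them. *)
Lemma obs_law_kernel (y : S T -> R) t (s : S t) a :
  sequential_exchangeability M y -> (t < T)%N -> 0 < Pr (cell M s a) ->
  obs_law M s a = Defs.kernel M s a.
Proof.
move=> exch tT cell0; apply/funext => s'; rewrite /obs_law /condPr.
suff -> : Pr ([set w | state M t.+1 w = s'] `&` cell M s a) =
    Defs.kernel M s a s' * Pr (cell M s a) by rewrite mulfK// gt_eqF.
pose X w := [tuple treatment M k w | k < t].
have XE b : [set w | X w = b] =
    [set w | forall k, (k < t)%N -> treatment M k w = nth a b k].
  apply/seteqP; split=> [w /= <- k kt|w /= H].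
    by rewrite -[k]/(val (Ordinal kt)) -tnth_nth tnth_mktuple.
  by apply: eq_from_tnth => i; rewrite tnth_mktuple (tnth_nth a) H.
have mX b : measurable [set w | X w = b].
  rewrite XE (_ : [set w | _] =
    \bigcap_(k in `I_t) [set w | treatment M k w = nth a b k])//.
  apply: fin_bigcap_measurable => [|k kt]; first exact: finite_II.
  exact/treatment_measurable/(ltn_trans kt).
have mcell := cell_measurable s a tT.
have mS' : measurable [set w | state M t.+1 w = s'] by exact: state_measurable.
rewrite /Pr (fine_probability_sum (prob M) mX (measurableI _ _ mS' mcell)).
rewrite (fine_probability_sum (prob M) mX mcell) mulr_sumr.
apply: eq_bigr => b _; rewrite XE.
(* The history [nth a b] follows [b] before [t] and takes its default value [a] at [t], since [b]
   has length [t]. *)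
have := exchangeable_transition (nth a b) s s' exch tT.
by rewrite nth_default ?size_tuple.
Qed.

Lemma condE_next_state t (s : S t) a (g : S t.+1 -> R) : (t < T)%N ->
  condE (fun w => g (state M t.+1 w)) (cell M s a) =
  \sum_s' obs_law M s a s' * g s'.
Proof.
move=> tT; rewrite /condE expectation_finite_valued/=; last 2 first.
- by move=> s'; exact: state_measurable.
- exact: cell_measurable.
rewrite mulr_suml; apply: eq_bigr => s' _.
by rewrite /obs_law /condPr [RHS]mulrAC (mulrC (g s')).
Qed.

End Transitions.

(** * Collapse of the maximin recursion to Q-learning *)

Section Reduction.
Context {R : realType} {T : nat} {S : nat -> finType} {A : finType}.
Variable M : scm R T S A.
Variable supp : forall t, S t -> A -> {set S t.+1}.
Variables (y : S T -> R) (Q : feasible_family M supp).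
Variables (W : forall t, S t -> R) (Wroot : R) (QL : forall t, S t -> A -> R).
Hypothesis maximinW : maximin_recursion Q y W Wroot.
Hypothesis exch : sequential_exchangeability M y.
Hypothesis pos : positivity M.
Hypothesis point_identified : forall t (s : S t) a, (t < T)%N ->
  is_subset1 (step_set Q s a).

Lemma step_set_obs_law t (s : S t) a : (t < T)%N ->
  step_set Q s a = [set obs_law M s a].
Proof.
move=> tT; have [_ _ _ kQ] := step_feasible Q s a tT.
rewrite (obs_law_kernel exch tT (pos s a tT)).
apply/seteqP; split=> [q Qq|_ ->//].
exact: point_identified Qq kQ.
Qed.

Lemma maximin_Q_reduced t (s : S t) a : (t < T)%N ->
  maximin_Q Q W s a = reduced_Q M supp W t s a.
Proof.
by move=> tT; rewrite /maximin_Q /min_over step_set_obs_law// image_set1 inf1.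
Qed.

Lemma maximin_W_reduced t (s : S t) : (t < T)%N ->
  W s = max_over (reduced_Q M supp W t s).
Proof.
move=> tT; have [_ /(_ t s tT) -> _] := maximinW.
by congr max_over; apply/funext => a; exact: maximin_Q_reduced.
Qed.

Lemma reduced_Q_condE t (s : S t) a : (t < T)%N ->
  reduced_Q M supp W t s a =
  condE (fun w => W (state M t.+1 w)) (cell M s a).
Proof.
move=> tT; rewrite condE_next_state// /reduced_Q big_mkcond/=.
apply: eq_bigr => s' _; case: ifPn => // s'supp.
(* The expectation sums over all of [S t.+1], the recursion over [supp t s a] only. The other terms
   vanish, as the observed law lies in a feasible set and so in the simplex on the support. *)
have [Qsimplex _ _ _] := step_feasible Q s a tT.
have /Qsimplex[_ _ ->//] : step_set Q s a (obs_law M s a).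
  by rewrite step_set_obs_law.
by rewrite mul0r.
Qed.

(** The bound on [t.+1] makes the next stage a decision stage, where [W] is itself a maximum of
    [reduced_Q]. *)
Lemma reduced_Q_bellman t (s : S t) a : (t.+1 < T)%N ->
  reduced_Q M supp W t s a =
  condE (fun w => max_over (reduced_Q M supp W t.+1 (state M t.+1 w)))
    (cell M s a).
Proof.
move=> tT; rewrite reduced_Q_condE; last exact: ltnW.
by congr condE; apply/funext => w; exact: maximin_W_reduced.
Qed.

Lemma reduced_Q_q_learning : q_learning M y QL ->
  forall t (s : S t) a, (t < T)%N -> reduced_Q M supp W t s a = QL s a.
Proof.
move=> [QLlast QLstep] t s a tT.
(* Backward induction: [n] counts the decision stages after [t]. *)
have [n tnT] : exists n, (t + n).+1 = T.
  by exists (T - t.+1)%N; rewrite -addSn subnKC.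
elim: n t tnT s a tT => [|n IHn] t tnT s a tT.
  have {tnT} tT1 : t.+1 = T by rewrite -tnT addn0.
  rewrite QLlast// reduced_Q_condE//; congr condE; apply/funext => w.
  have [<- _ _] := maximinW.
  (* The terminal condition lives on [S T], the goal on [S t.+1]; generalising [T] to [k] allows
     rewriting in these dependent types. *)
  have stage k : t.+1 = k -> W (state M t.+1 w) = W (state M k w) by move=> <-.
  exact: stage.
have t1T : (t.+1 < T)%N by rewrite -tnT addnS !ltnS leq_addr.
rewrite QLstep// reduced_Q_bellman//; congr condE; apply/funext => w.
by congr max_over; apply/funext => a'; apply: IHn => //; rewrite addSnnS.
Qed.

End Reduction.

Theorem corollary4p11 (R : realType) (T : nat) (A : finType) (hT : (1 <= T)%N) :
  (forall (S : nat -> finType) (M : scm R T S A) (G : pred nat)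
      (supp : forall t, S t -> A -> {set S t.+1}) (y : S T -> R)
      (Q : feasible_family M supp)
      (W : forall t, S t -> R) (Wroot : R) (QL : forall t, S t -> A -> R),
    respects_graph M G ->
    respects_support M supp ->
    maximin_recursion Q y W Wroot ->
    q_learning M y QL ->
    sequential_exchangeability M y ->
    positivity M ->
    (forall t (s : S t) a, (t < T)%N -> is_subset1 (step_set Q s a)) ->
    [/\ forall t (s : S t) a, (t < T)%N -> step_set Q s a = [set obs_law M s a],
        forall t (s : S t) a, (t < T)%N ->
          maximin_Q Q W s a = reduced_Q M supp W t s a,
        forall t (s : S t), (t < T)%N -> W t s = max_over (reduced_Q M supp W t s)
      & forall d : forall t, S t -> A,
          greedy T (reduced_Q M supp W) d <-> greedy T QL d])
  /\
  (forall (L : nat -> finType) (M : scm R T (hist L A) A) (G : pred nat)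
      (supp : forall t, hist L A t -> A -> {set hist L A t.+1})
      (y : hist L A T -> R) (Q : feasible_family M supp)
      (W : forall t, hist L A t -> R) (Wroot : R)
      (QL : forall t, hist L A t -> A -> R),
    history_scm M ->
    respects_graph M G ->
    respects_support M supp ->
    maximin_recursion Q y W Wroot ->
    q_learning M y QL ->
    sequential_exchangeability M y ->
    positivity M ->
    (forall t (h : hist L A t) a, (t < T)%N -> is_subset1 (step_set Q h a)) ->
    [/\ forall t (h : hist L A t) a, (t < T)%N -> reduced_Q M supp W t h a = QL t h a,
        forall t (h : hist L A t) a, (t.+1 < T)%N ->
          reduced_Q M supp W t h a =
          condE (fun w => max_over (reduced_Q M supp W t.+1 (state M t.+1 w))) (cell M h a),
        forall t (h : hist L A t), (t < T)%N -> W t h = max_over (reduced_Q M supp W t h)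
      & forall t (h : hist L A t), (t < T)%N -> W t h = max_over (QL t h)]).
Proof.
split.
  move=> S M G supp y Q W Wroot QL _ _ maximinW qQL exch pos point_identified.
  have reduced_QL := reduced_Q_q_learning maximinW exch pos point_identified qQL.
  split=> [t s a|t s a|t s|d].
  - exact: (step_set_obs_law exch pos point_identified).
  - exact: (maximin_Q_reduced _ exch pos point_identified).
  - exact: (maximin_W_reduced maximinW exch pos point_identified).
  - have reduced_QLE t (s : S t) : (t < T)%N -> reduced_Q M supp W t s = QL t s.
      by move=> tT; apply/funext => a; exact: reduced_QL.
    by split=> gr t s tT; have := gr t s tT; rewrite reduced_QLE.
(* The history formulation is the instance of the reduction whose state space at stage [t] is
   [hist L A t]. *)
move=> L M G supp y Q W Wroot QL _ _ _ maximinW qQL exch pos point_identified.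
have reduced_QL := reduced_Q_q_learning maximinW exch pos point_identified qQL.
split=> [//|t h a tT|t h tT|t h tT].
- exact: (reduced_Q_bellman maximinW exch pos point_identified).
- exact: (maximin_W_reduced maximinW exch pos point_identified).
- rewrite (maximin_W_reduced maximinW exch pos point_identified)//.
  by congr max_over; apply/funext => a; exact: reduced_QL.
Qed.
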